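(* Let $\mathcal{LT}$ be the free nonsymmetric operad, in the category of $\mathbb{Z}$-graded vector spaces over a field of characteristic $0$ with Koszul signs, generated by one ternary operation $t$ of odd homological degree. Let $\alpha=t\circ_1 t+t\circ_2 t+t\circ_3 t$. Then, with respect to the path-lex monomial order, $\{\alpha\}$ is a Gröbner basis for the operad ideal $\langle\alpha\rangle$ of $\mathcal{LT}$.
   Context: Trees. A ternary tree is a rooted plane tree in which every node has either no children (a leaf) or exactly $3$ children (an internal node). The weight of a tree $p$ is its number $w(p)$ of internal nodes; its arity $\ell(p)=1+2w(p)$ is its number of leaves, indexed from left to right. The basic tree $t$ is the ternary tree of weight $1$. $\mathcal{T}(n)$ is the set of ternary trees of arity $n$ ($n$ odd). Odd free operad. $\mathcal{LT}=\bigoplus_n\mathcal{LT}(n)$ is the free nonsymmetric operad on $t$ of odd degree. The parity $|p|\in\{0,1\}$ of a tree monomial $p$ is the parity of its weight. The partial compositions are bilinear and, for tree monomials $p,q,r$, satisfy $$(p\circ_i q)\circ_j r=\begin{cases} p\circ_i(q\circ_{j-i+1}r), & i\le j\le i+\ell(q)-1,\\ (-1)^{|q||r|}(p\circ_{j-\ell(q)+1}r)\circ_i q, & i+\ell(q)\le j\le \ell(p)+\ell(q)-1,\\ (-1)^{|q||r|}(p\circ_j r)\circ_{i+\ell(r)-1}q, & 1\le j\le i-1.\end{cases}$$ Every iterated partial composition of copies of $t$ corresponds to an underlying ternary tree (grafting at leaf $i$ for each $\circ_i$) and is determined by that tree up to sign; choosing one such composition for each tree gives a basis of $\mathcal{LT}(n)$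 indexed by $\mathcal{T}(n)$, and the notions below do not depend on the choices of sign. The ideal $\langle\alpha\rangle$ is the smallest homogeneous (i.e. direct sum of arity components) subspace $\mathcal{S}\subseteq\mathcal{LT}$ containing $\alpha$ such that $f\in\mathcal{S}(m)$, $g\in\mathcal{LT}(n)$ imply $f\circ_i g,\ g\circ_j f\in\mathcal{S}$ for all $1\le i\le m$, $1\le j\le n$. Path-lex order. For $p\in\mathcal{T}(n)$, $\mathrm{path}(p)=(a_1,\dots,a_n)$ where $a_i$ is the length of the path from the root to leaf $i$; a tree is determined by its path sequence. For $p,q\in\mathcal{T}(n)$, $p\prec q$ means $\mathrm{path}(p)$ precedes $\mathrm{path}(q)$ in lexicographic order. For nonzero $f\in\mathcal{LT}(n)$ the leading monomial $\ell m(f)$ is the greatest tree in path-lex order occurring in $f$ with nonzero coefficient. Divisibility and Gröbner bases. A tree $q$ is divisible by a tree $p$ ($p\mid q$) if $p$ is a subtree of $q$, i.e. (up to sign) $q$ is obtained from $p$ by a sequence of partial compositions with other trees: $q=r\circ_i p'$ for some tree $r$ and index $i$, where $p'$ is obtained by grafting some trees (possibly trivial) onto the leaves of $p$. A finite set $G$ of nonzero elements, each lying in some $\mathcal{LT}(n)$, is a Gröbner basis for $I=\langle G\rangle$ if for every nonzero $f\in I\cap\mathcal{LT}(n)$ (any $n$) there is $g\in G$ with $\ell m(g)\mid\ell m(f)$. *)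

(* Defs.v *)
From HB Require Import structures.
From mathcomp Require Import all_boot all_order all_algebra.
From mathcomp Require Import finmap.
From mathcomp.multinomials Require Export monalg.
From mathcomp Require Import zify ring.

Set Implicit Arguments.
Unset Strict Implicit.
Unset Printing Implicit Defensive.

Import Order.TTheory GRing.Theory.
Local Open Scope ring_scope.

Inductive tree : Type := Leaf | Node of tree & tree & tree.

Fixpoint tree_encode (p : tree) : GenTree.tree unit :=
  match p with
  | Leaf => GenTree.Leaf tt
  | Node a b c => GenTree.Node 0 [:: tree_encode a; tree_encode b; tree_encode c]
  end.

Fixpoint tree_decode (u : GenTree.tree unit) : option tree :=
  match u with
  | GenTree.Leaf _ => Some Leaf
  | GenTree.Node _ [:: a; b; c] =>
      match tree_decode a, tree_decode b, tree_decode c with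
      | Some a', Some b', Some c' => Some (Node a' b' c')
      | _, _, _ => None
      end
  | _ => None
  end.

Lemma tree_encodeK : pcancel tree_encode tree_decode.
Proof. by elim=> //= a -> b -> c ->. Qed.

HB.instance Definition _ := Choice.copy tree (pcan_type tree_encodeK).

Fixpoint weight (p : tree) : nat :=
  if p is Node a b c then (weight a + weight b + weight c).+1 else 0%N.

Fixpoint arity (p : tree) : nat :=
  if p is Node a b c then (arity a + arity b + arity c)%N else 1%N.

Lemma arityE p : arity p = (1 + 2 * weight p)%N.
Proof. by elim: p => //= a -> b -> c ->; lia. Qed.

Definition basic_tree : tree := Node Leaf Leaf Leaf.

(* Leaves are numbered from left to right starting from 1. [graft p i q] puts
   the root of q at leaf i of p; for i outside 1..arity p it is p itself. *)
Fixpoint graft (p : tree) (i : nat) (q : tree) : tree :=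
  match p with
  | Leaf => if i == 1%N then q else Leaf
  | Node a b c =>
      if (i <= arity a)%N then Node (graft a i q) b c
      else if (i <= arity a + arity b)%N then Node a (graft b (i - arity a) q) c
      else Node a b (graft c (i - arity a - arity b) q)
  end.

(* [graft_all p s] grafts the trees of s, in order, onto all the leaves of p;
   meaningful when size s = arity p. *)
Fixpoint graft_all (p : tree) (s : seq tree) : tree :=
  match p with
  | Leaf => head Leaf s
  | Node a b c =>
      Node (graft_all a (take (arity a) s))
           (graft_all b (take (arity b) (drop (arity a) s)))
           (graft_all c (drop (arity a + arity b) s))
  end.

Definition divides (p q : tree) : Prop :=
  exists (r : tree) (i : nat) (s : seq tree),
    [/\ (1 <= i <= arity r)%N, size s = arity p & q = graft r i (graft_all p s)].

Fixpoint path_seq (p : tree) : seq nat :=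
  match p with
  | Leaf => [:: 0%N]
  | Node a b c => map S (path_seq a ++ path_seq b ++ path_seq c)
  end.

Definition path_le : rel tree :=
  fun p q => (path_seq p <= path_seq q :> seqlexi nat)%O.

Definition path_lt : rel tree :=
  fun p q => (path_seq p < path_seq q :> seqlexi nat)%O.

Lemma size_path_seq p : size (path_seq p) = arity p.
Proof.
by elim: p => //= a <- b <- c <-; rewrite size_map !size_cat addnA.
Qed.

Lemma path_seq_inj : injective path_seq.
Proof.
suff prefix_inj p q s s' :
    path_seq p ++ s = path_seq q ++ s' -> p = q /\ s = s'.
  by move=> p q e; case: (@prefix_inj p q [::] [::]); rewrite ?cats0.
pose sh k r := map (addn k) (path_seq r).
have shN k a b c : sh k (Node a b c) = sh k.+1 a ++ sh k.+1 b ++ sh k.+1 c.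
  rewrite /sh /= -!map_cat -map_comp; apply: eq_map => x /=; lia.
have sh_head k r : exists x u, sh k r = x :: u /\ (k <= x)%N.
  elim: r k => [|a IHa b _ c _] k; first by exists (k + 0)%N, [::]; split=> //; lia.
  rewrite shN; have [x [u [-> kx]]] := IHa k.+1.
  by exists x, (u ++ sh k.+1 b ++ sh k.+1 c); split=> //; lia.
have key k p' q' t t' : sh k p' ++ t = sh k q' ++ t' -> p' = q' /\ t = t'.
  elim: p' k q' t t' => [|a IHa b IHb c IHc] k [|a' b' c'] t t'.
  - by case.
  - rewrite shN; have [x [u [-> kx]]] := sh_head k.+1 a'.
    by case=> xE; exfalso; lia.
  - rewrite shN; have [x [u [-> kx]]] := sh_head k.+1 a.
    by case=> xE; exfalso; lia.
  - by rewrite !shN -!catA => /IHa[-> /IHb[-> /IHc[-> ->]]].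
have sh0 r : sh 0%N r = path_seq r by rewrite /sh map_id_in.
by move=> e; apply: (key 0%N); rewrite !sh0.
Qed.

(* The number of internal nodes of p that come after leaf i when the nodes and
   leaves of p are listed in depth-first, left-to-right preorder. *)
Fixpoint after (p : tree) (i : nat) : nat :=
  match p with
  | Leaf => 0%N
  | Node a b c =>
      if (i <= arity a)%N then (after a i + weight b + weight c)%N
      else if (i <= arity a + arity b)%N then (after b (i - arity a) + weight c)%N
      else after c (i - arity a - arity b)
  end.

(* The vector space with basis all trees; its component LT(n) is the subspace
   [homogeneous n] below. A tree p has degree d * weight p for d odd the degree
   of t, so all Koszul signs depend only on parities of weights. *)
Notation LT F := {malg F[tree]}.

(* The basis element indexed by a tree is the composition of copies of t made in
   preorder (see [Node_compE]). As t is odd, inserting q at leaf i of p moves it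
   past the nodes of p that follow leaf i, which gives the Koszul sign below. *)
Definition comp_sign {F : fieldType} (p : tree) (i : nat) (q : tree) : F :=
  (-1) ^+ (weight q * after p i).

Definition monomial {F : fieldType} (p : tree) : LT F := << p >>.

(* The partial composition f \o_i g. *)
Definition comp {F : fieldType} (i : nat) (f g : LT F) : LT F :=
  \sum_(p <- msupp f) \sum_(q <- msupp g)
    (f@_p * g@_q * comp_sign p i q) *: monomial (graft p i q).

Section Operad.

Variable F : fieldType.
Implicit Types (f g h : LT F) (p q r : tree) (i j m n : nat).

Definition generator : LT F := monomial basic_tree.

Definition homogeneous n f : bool := all (fun p => arity p == n) (msupp f).

Definition component n f : LT F :=
  \sum_(p <- msupp f | arity p == n) f@_p *: monomial p.

Record operad_ideal (S : LT F -> Prop) : Prop := OperadIdeal {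
  ideal0 : S 0;
  idealD : forall f g, S f -> S g -> S (f + g);
  idealZ : forall (c : F) f, S f -> S (c *: f);
  ideal_component : forall n f, S f -> S (component n f);
  ideal_compl : forall m n i f g, homogeneous m f -> homogeneous n g ->
    S f -> (1 <= i <= m)%N -> S (comp i f g);
  ideal_compr : forall m n j f g, homogeneous m f -> homogeneous n g ->
    S f -> (1 <= j <= n)%N -> S (comp j g f)
}.

Definition ideal_gen (G : seq (LT F)) (f : LT F) : Prop :=
  forall S : LT F -> Prop, operad_ideal S -> {in G, forall g, S g} -> S f.

(* The greatest tree of the support; [Leaf] when f = 0. *)
Definition lm f : tree := last Leaf (sort path_le (msupp f)).

Definition groebner_basis (G : seq (LT F)) (I : LT F -> Prop) : Prop :=
  [/\ {in G, forall g, g != 0 /\ exists n, homogeneous n g},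
      forall f, I f <-> ideal_gen G f
    & forall n f, f != 0 -> homogeneous n f -> I f ->
        exists2 g, g \in G & divides (lm g) (lm f)].

Definition alpha : LT F :=
  comp 1 generator generator + comp 2 generator generator
  + comp 3 generator generator.

Lemma lmP f : f != 0 ->
  lm f \in msupp f /\ (forall q, q \in msupp f -> q != lm f -> path_lt q (lm f)).
Proof.
move=> f0; rewrite /lm; set s := sort _ _.
have tot : total path_le by move=> p q; apply: le_total.
have tr : transitive path_le by move=> p q r; apply: le_trans.
have mem_s q : (q \in s) = (q \in msupp f) by rewrite mem_sort.
have srt : sorted path_le s by apply: sort_sorted.
have : s != [::].
  apply: contra f0 => /eqP s0; apply/eqP/malgP => q.
  by rewrite mcoeff0 mcoeff_outdom // -mem_s s0.
case: (lastP s) srt mem_s => // u x srt mem_s _; rewrite last_rcons; split.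
  by rewrite -mem_s mem_rcons mem_head.
move=> q; rewrite -mem_s mem_rcons inE => /orP[/eqP->|qu qx].
  by rewrite eqxx.
move: srt; rewrite (sorted_pairwise tr) pairwise_rcons.
move=> /andP[/allP/(_ q qu) le_qx _].
rewrite /path_lt lt_neqAle [X in _ && X]le_qx andbT.
by apply: contra qx => /eqP/path_seq_inj->.
Qed.

Lemma weight_graft p i q : (1 <= i <= arity p)%N ->
  weight (graft p i q) = (weight p + weight q)%N.
Proof.
elim: p i => [|a IHa b IHb c IHc] i /=; first by case: eqP; lia.
move=> ir; case: leqP => h1 /=; first by rewrite IHa; lia.
by case: leqP => h2 /=; rewrite ?IHb ?IHc; lia.
Qed.

Lemma arity_graft p i q : (1 <= i <= arity p)%N ->
  (arity (graft p i q)).+1 = (arity p + arity q)%N.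
Proof. by move=> ir; rewrite !arityE weight_graft //; lia. Qed.

Lemma mcoeff_monomial p q : (monomial p : LT F)@_q = (p == q)%:R.
Proof. exact: mcoeffU. Qed.

Lemma mcoeff_LTZ (c : F) f p : (c *: f)@_p = c * f@_p.
Proof. exact: mcoeffZ. Qed.

Lemma mcoeff_LTD f g p : (f + g)@_p = f@_p + g@_p.
Proof. exact: mcoeffD. Qed.

Lemma msupp_monomial p : msupp (monomial p : LT F) = [fset p]%fset.
Proof. by rewrite /monomial msuppU oner_eq0. Qed.

Lemma compEw (d e : {fset tree}) i f g :
  (msupp f `<=` d)%fset -> (msupp g `<=` e)%fset ->
  comp i f g = \sum_(p <- d) \sum_(q <- e)
    (f@_p * g@_q * comp_sign p i q) *: monomial (graft p i q).
Proof.
move=> fd ge; rewrite /comp (big_fset_incl _ fd) /=; last first.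
  move=> p _ /mcoeff_outdom ->; apply: big1 => q _.
  by rewrite !mul0r scale0r.
apply: eq_bigr => p _; rewrite (big_fset_incl _ ge) //= => q _ /mcoeff_outdom ->.
by rewrite mulr0 mul0r scale0r.
Qed.

Lemma comp_linearl i (c : F) f f' g :
  comp i (c *: f + f') g = c *: comp i f g + comp i f' g.
Proof.
pose d := (msupp (c *: f + f') `|` (msupp f `|` msupp f'))%fset.
rewrite !(@compEw d (msupp g)) //;
  try by rewrite /d; apply/fsubsetP => x; rewrite !inE => ->; rewrite ?orbT.
rewrite scaler_sumr -big_split /=; apply: eq_bigr => p _.
rewrite scaler_sumr -big_split /=; apply: eq_bigr => q _.
by rewrite mcoeff_LTD mcoeff_LTZ scalerA -scalerDl; congr (_ *: _); ring.
Qed.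

Lemma comp_linearr i (c : F) f g g' :
  comp i f (c *: g + g') = c *: comp i f g + comp i f g'.
Proof.
pose d := (msupp (c *: g + g') `|` (msupp g `|` msupp g'))%fset.
rewrite !(@compEw (msupp f) d) //;
  try by rewrite /d; apply/fsubsetP => x; rewrite !inE => ->; rewrite ?orbT.
rewrite scaler_sumr -big_split /=; apply: eq_bigr => p _.
rewrite scaler_sumr -big_split /=; apply: eq_bigr => q _.
by rewrite mcoeff_LTD mcoeff_LTZ scalerA -scalerDl; congr (_ *: _); ring.
Qed.

Lemma comp_monomial i p q :
  comp i (monomial p) (monomial q) =
  comp_sign p i q *: monomial (graft p i q) :> LT F.
Proof.
rewrite /comp !msupp_monomial !big_seq_fset1 !mcoeff_monomial !eqxx.
by rewrite !mul1r.
Qed.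

Lemma compZl i (c : F) f g : comp i (c *: f) g = c *: comp i f g.
Proof.
have := comp_linearl i c f 0 g; rewrite !addr0 => ->.
by rewrite [comp i 0 g]/comp msupp0 big_seq_fset0 addr0.
Qed.

Lemma compZr i (c : F) f g : comp i f (c *: g) = c *: comp i f g.
Proof.
have := comp_linearr i c f g 0; rewrite !addr0 => ->.
rewrite [comp i f 0]/comp [X in _ + X]big1 ?addr0 // => p _.
by rewrite msupp0 big_seq_fset0.
Qed.

Lemma graft_Leaf p i : graft p i Leaf = p.
Proof.
elim: p i => [|a IHa b IHb c IHc] i /=; first by case: eqP.
by case: leqP => _; [rewrite IHa | case: leqP => _; rewrite ?IHb ?IHc].
Qed.

Lemma comp_Leafr i p :
  comp i (monomial p) (monomial Leaf) = monomial p :> LT F.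
Proof. by rewrite comp_monomial graft_Leaf /comp_sign mul0n scale1r. Qed.

Lemma comp_Leafl p : comp 1 (monomial Leaf) (monomial p) = monomial p :> LT F.
Proof. by rewrite comp_monomial /comp_sign muln0 scale1r. Qed.

(* Decides the tests of [graft] and [after] on leaf numbers. *)
Local Ltac if_lia :=
  repeat match goal with
  | |- context [if ?x then _ else _] =>
      first [have -> : x = true by lia | have -> : x = false by lia]; rewrite /=
  end.

Lemma graft_seq p q r i j : (1 <= i <= arity p)%N ->
  (i <= j <= i + arity q - 1)%N ->
  graft (graft p i q) j r = graft p i (graft q (j - i + 1) r) /\
  after (graft p i q) j = (after q (j - i + 1) + after p i)%N.
Proof.
elim: p i j => [|a IHa b IHb c IHc] i j /=.
  move=> ir jr; have -> : i = 1%N by lia.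
  by rewrite eqxx addn0 subnK //; lia.
move=> ir jr; case: leqP => h1 /=.
  have ha : (arity (graft a i q)).+1 = (arity a + arity q)%N.
    by apply: arity_graft; lia.
  have [||ga ea] := IHa i j; [lia | lia |].
  by if_lia; rewrite ga ea; split=> //; lia.
case: leqP => h2 /=.
  have hb : (arity (graft b (i - arity a) q)).+1 = (arity b + arity q)%N.
    by apply: arity_graft; lia.
  have [||gb eb] := IHb (i - arity a)%N (j - arity a)%N; [lia | lia |].
  have -> : (j - i + 1 = j - arity a - (i - arity a) + 1)%N by lia.
  by if_lia; rewrite gb eb; split=> //; lia.
have [||gc ec] := IHc (i - arity a - arity b)%N (j - arity a - arity b)%N;
  [lia | lia |].
have -> : (j - i + 1 =
           j - arity a - arity b - (i - arity a - arity b) + 1)%N by lia.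
by if_lia; rewrite gc ec.
Qed.

Lemma graft_par p q r i j : (1 <= i)%N -> (i < j <= arity p)%N ->
  [/\ graft (graft p i q) (j + arity q - 1) r = graft (graft p j r) i q,
      after (graft p i q) (j + arity q - 1) = after p j
    & after (graft p j r) i = (after p i + weight r)%N].
Proof.
have q0 : (0 < arity q)%N by rewrite arityE.
have r0 : (0 < arity r)%N by rewrite arityE.
elim: p i j => [|a IHa b IHb c IHc] i j /=; first lia.
move=> i0 ij; case: (leqP i (arity a)) => h1 /=.
  have ha : (arity (graft a i q)).+1 = (arity a + arity q)%N.
    by apply: arity_graft; lia.
  case: (leqP j (arity a)) => h2 /=.
    have ha' : (arity (graft a j r)).+1 = (arity a + arity r)%N.
      by apply: arity_graft; lia.
    have [||ga ea ea'] := IHa i j; [lia | lia |].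
    by if_lia; rewrite ga ea ea'; split=> //; lia.
  case: (leqP j (arity a + arity b)) => h3 /=.
    have wb : weight (graft b (j - arity a) r) = (weight b + weight r)%N.
      by apply: weight_graft; lia.
    have e : (j + arity q - 1 - arity (graft a i q) = j - arity a)%N by lia.
    by if_lia; rewrite e wb; split=> //; lia.
  have wc : weight (graft c (j - arity a - arity b) r)
            = (weight c + weight r)%N by apply: weight_graft; lia.
  have e : (j + arity q - 1 - arity (graft a i q) - arity b
            = j - arity a - arity b)%N by lia.
  by if_lia; rewrite e wc; split=> //; lia.
case: (leqP i (arity a + arity b)) => h2 /=.
  have hb : (arity (graft b (i - arity a) q)).+1 = (arity b + arity q)%N.
    by apply: arity_graft; lia.
  have h3 : (arity a < j)%N by lia.
  case: (leqP j (arity a + arity b)) => h4 /=.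
    have hb' : (arity (graft b (j - arity a) r)).+1 = (arity b + arity r)%N.
      by apply: arity_graft; lia.
    have [||gb eb eb'] := IHb (i - arity a)%N (j - arity a)%N; [lia | lia |].
    have e : (j + arity q - 1 - arity a = j - arity a + arity q - 1)%N by lia.
    by if_lia; rewrite e gb eb eb'; split=> //; lia.
  have wc : weight (graft c (j - arity a - arity b) r)
            = (weight c + weight r)%N by apply: weight_graft; lia.
  have e : (j + arity q - 1 - arity a - arity (graft b (i - arity a) q)
            = j - arity a - arity b)%N by lia.
  by if_lia; rewrite e wc; split=> //; lia.
have [||gc ec ec'] := IHc (i - arity a - arity b)%N (j - arity a - arity b)%N;
  [lia | lia |].
have e : (j + arity q - 1 - arity a - arity b
          = j - arity a - arity b + arity q - 1)%N by lia.
by if_lia; rewrite e gc ec ec'.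
Qed.

(* The three lemmas [comp_assoc_*] are the defining relations of an odd operad,
   and [Node_compE] builds every basis element from t, without any sign. *)
Local Notation "[ p ]" := (monomial p : LT F) (at level 0).

Lemma comp_assoc_seq p q r i j : (1 <= i <= arity p)%N ->
  (i <= j <= i + arity q - 1)%N ->
  comp j (comp i [p] [q]) [r] = comp i [p] (comp (j - i + 1) [q] [r]).
Proof.
move=> ir jr; rewrite !comp_monomial compZl compZr !comp_monomial !scalerA.
have [-> ea] := graft_seq r ir jr.
congr (_ *: _); rewrite /comp_sign ea weight_graft; last lia.
by rewrite -!exprD; congr (_ ^+ _); lia.
Qed.

Lemma comp_assoc_right p q r i j : (1 <= i <= arity p)%N ->
  (i + arity q <= j <= arity p + arity q - 1)%N ->
  comp j (comp i [p] [q]) [r] =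
  (-1) ^+ (weight q * weight r) *: comp i (comp (j - arity q + 1) [p] [r]) [q].
Proof.
move=> ir jr; rewrite !comp_monomial !compZl !comp_monomial !scalerA.
have [||g1 e1 e2] := @graft_par p q r i (j - arity q + 1)%N; try lia.
rewrite (_ : _ + _ - 1 = j)%N in g1 e1; last lia.
rewrite g1; congr (_ *: _); rewrite /comp_sign e1 e2.
rewrite -!exprD -[LHS]signr_odd -[RHS]signr_odd; congr (_ ^+ nat_of_bool _).
rewrite mulnDr !oddD.
by case: (odd (weight q * weight r)); case: (odd (weight q * after p i));
  case: (odd (weight r * after p _)).
Qed.

Lemma comp_assoc_left p q r i j : (1 <= i <= arity p)%N -> (1 <= j <= i - 1)%N ->
  comp j (comp i [p] [q]) [r] =
  (-1) ^+ (weight q * weight r) *: comp (i + arity r - 1) (comp j [p] [r]) [q].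
Proof.
move=> ir jr; rewrite !comp_monomial !compZl !comp_monomial !scalerA.
have [||g1 e1 e2] := @graft_par p r q j i; try lia.
rewrite g1; congr (_ *: _); rewrite /comp_sign e1 e2.
rewrite -!exprD -[LHS]signr_odd -[RHS]signr_odd; congr (_ ^+ nat_of_bool _).
rewrite mulnDr [(weight r * weight q)%N]mulnC !oddD.
by case: (odd (weight q * weight r)); case: (odd (weight r * after p j));
  case: (odd (weight q * _)).
Qed.

Lemma Node_compE a b c :
  [Node a b c] = comp (arity a + arity b + 1)
    (comp (arity a + 1) (comp 1 generator [a]) [b]) [c].
Proof.
have ha : (0 < arity a)%N by rewrite arityE.
have hb : (0 < arity b)%N by rewrite arityE.
rewrite /generator comp_monomial /comp_sign /= muln0 scale1r.
rewrite comp_monomial /comp_sign /=; if_lia.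
rewrite muln0 scale1r comp_monomial /comp_sign /=; if_lia.
by rewrite muln0 scale1r.
Qed.

Lemma alphaE :
  alpha = [Node basic_tree Leaf Leaf] + [Node Leaf basic_tree Leaf]
          + [Node Leaf Leaf basic_tree].
Proof.
by rewrite /alpha /generator !comp_monomial /comp_sign /= !scale1r.
Qed.

End Operad.

(* Main.v *)
Require Import Defs.
From HB Require Import structures.
From mathcomp Require Import all_boot all_order all_algebra.
From mathcomp Require Import finmap ssrAC zify.
Import Order.TTheory GRing.Theory.
Local Open Scope ring_scope.

(** Call a tree normal if the first child of each of its nodes is a leaf. A tree
    that is not normal is divisible by [Node basic_tree Leaf Leaf], the leading
    monomial of alpha. So it suffices that no nonzero homogeneous element of the
    ideal has a normal leading monomial.

    To see this, build an algebra over the quotient by the ideal. Its product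
    [mu] has to satisfy, with s the grading automorphism,
      mu (mu x y z) u v + mu (s x) (mu y z u) v
        + mu (s x) (s y) (mu z u v) = 0.
    Take mu Leaf q r = Node Leaf q r and let this relation with x = Leaf define
    the product of Node Leaf y z with u and v; this is a recursion on the first
    factor. That the relation then holds for all x ([mu_relation]) is the
    confluence of the only critical pair, and follows by induction on x.

    The operad acts on this algebra ([eval_graft]), and the elements that act
    by zero form an ideal containing alpha, hence containing the ideal generated
    by alpha ([ideal_acts_by_zero]). Now let a tree p act on leaves only: the
    result [normal_form p] is p itself if p is normal, and in all cases involves
    only trees that are at most p ([normal_form_id], [normal_form_le]). If f acts
    by zero and its leading monomial is normal, then the coefficient of that
    monomial in the value of f on leaves is its coefficient in f, which is
    nonzero: a contradiction ([lm_not_normal]). *)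

Set Implicit Arguments.
Unset Strict Implicit.
Unset Printing Implicit Defensive.

Section PartiallyAssociativeAlgebra.

Variable F : fieldType.
Implicit Types (f g h x y z u v : LT F) (p q a b c d e : tree) (k m n : nat).

Local Notation "[ p ]" := (monomial p : LT F) (at level 0).
Local Notation comp := Defs.comp.
Local Notation path_le := Defs.path_le.
Local Notation "[L]" := (monomial Leaf : LT F) (at level 0).

(** * Linear extension of maps defined on trees *)

Definition lin_ext (phi : tree -> LT F) f : LT F :=
  \sum_(p <- msupp f) f@_p *: phi p.

Lemma lin_extEw (D : {fset tree}) phi f : (msupp f `<=` D)%fset ->
  lin_ext phi f = \sum_(p <- D) f@_p *: phi p.
Proof.
move=> fD; rewrite /lin_ext (big_fset_incl _ fD) //= => p _ /mcoeff_outdom ->.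
by rewrite scale0r.
Qed.

Lemma lin_ext_is_linear phi : linear (lin_ext phi).
Proof.
move=> c f g; pose D := (msupp (c *: f + g) `|` (msupp f `|` msupp g))%fset.
rewrite !(@lin_extEw D);
  try by rewrite /D; apply/fsubsetP => p; rewrite !inE => ->; rewrite ?orbT.
rewrite scaler_sumr -big_split /=; apply: eq_bigr => p _.
by rewrite mcoeff_LTD mcoeff_LTZ scalerA -scalerDl.
Qed.

HB.instance Definition _ phi :=
  GRing.isLinear.Build F (LT F) (LT F) _ (lin_ext phi) (@lin_ext_is_linear phi).

Lemma lin_ext_monomial phi p : lin_ext phi [p] = phi p.
Proof.
by rewrite /lin_ext msupp_monomial big_seq_fset1 mcoeff_monomial eqxx scale1r.
Qed.

Lemma eq_lin_ext phi psi f : {in msupp f, phi =1 psi} ->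
  lin_ext phi f = lin_ext psi f.
Proof. by move=> eq_pp; apply: eq_big_seq => p /eq_pp ->. Qed.

Lemma lin_ext0 f : lin_ext (fun=> 0) f = 0.
Proof. by apply: big1 => p _; rewrite scaler0. Qed.

Lemma lin_extP (phi : LT F -> LT F) : linear phi ->
  forall f, phi f = lin_ext (fun p => phi [p]) f.
Proof.
move=> phi_lin f.
pose h := GRing.isLinear.Build F (LT F) (LT F) _ phi phi_lin.
pose phi' : {linear LT F -> LT F} := HB.pack phi h.
rewrite -[phi]/(phi' : _ -> _) {1}[f]monalgE linear_sum; apply: eq_bigr => p _.
rewrite -linearZ /=; congr (phi _); apply/malgP => q.
by rewrite mcoeff_LTZ mcoeff_monomial mcoeffU mulr_natr.
Qed.

Lemma lin_ext_lincomb (k : F) phi psi f :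
  lin_ext (fun p => k *: phi p + psi p) f = k *: lin_ext phi f + lin_ext psi f.
Proof.
rewrite /lin_ext scaler_sumr -big_split /=; apply: eq_bigr => p _.
by rewrite scalerDr !scalerA mulrC.
Qed.

Lemma mcoeff_lin_ext phi f q :
  (lin_ext phi f)@_q = \sum_(p <- msupp f) f@_p * (phi p)@_q.
Proof. by rewrite /lin_ext raddf_sum; apply: eq_bigr => p _; exact: mcoeff_LTZ. Qed.

Lemma msupp_lin_ext phi f q :
  q \in msupp (lin_ext phi f) -> exists2 p, p \in msupp f & q \in msupp (phi p).
Proof.
have [/hasP[p pf qp] _|no] := boolP (has (fun p => q \in msupp (phi p)) (msupp f)).
  by exists p.
rewrite -mcoeff_neq0 mcoeff_lin_ext big1_seq ?eqxx //= => p pf.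
rewrite [X in _ * X]mcoeff_outdom ?mulr0 //.
by apply: contra no => qp; apply/hasP; exists p.
Qed.

Lemma linear_ext (phi psi : LT F -> LT F) : linear phi -> linear psi ->
  (forall p, phi [p] = psi [p]) -> phi =1 psi.
Proof.
move=> phi_lin psi_lin eq_pp f; rewrite (lin_extP phi_lin) (lin_extP psi_lin).
exact: eq_lin_ext.
Qed.

Lemma linear_morph (phi : LT F -> LT F) : linear phi ->
  [/\ forall f g, phi (f + g) = phi f + phi g, forall f, phi (- f) = - phi f,
      forall (k : F) f, phi (k *: f) = k *: phi f & phi 0 = 0].
Proof.
move=> phi_lin; pose h := GRing.isLinear.Build F (LT F) (LT F) _ phi phi_lin.
pose phi' : {linear LT F -> LT F} := HB.pack phi h.
by rewrite -[phi]/(phi' : _ -> _); split=> *;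
  rewrite ?linearD ?linearN ?linearZ ?linear0.
Qed.

Lemma lincombD (k : F) f f' g g' :
  k *: f + f' + (k *: g + g') = k *: (f + g) + (f' + g').
Proof. by rewrite addrACA scalerDr. Qed.

(** * The ternary product on trees *)

(** The quotient of the free operad is modelled on trees. A product whose first
    factor is a leaf is grafting; when the first factor is [Node Leaf d e], the
    relation alpha = 0, solved for its leading term, dictates the value. The sign
    appears because the inner t moves past d. Trees having a node as first child
    of the root are sums of smaller ones in the quotient, so the algebra
    has no use for them, and letting them be zero as first factors is compatible
    with the relation. *)
Fixpoint mu_basis (p q r : tree) : LT F :=
  match p with
  | Leaf => [Node Leaf q r]
  | Node Leaf d e =>
      - (lin_ext (fun b => [Node Leaf b r]) (mu_basis d e q)
         + (-1) ^+ weight d *: lin_ext (fun c => [Node Leaf d c]) (mu_basis e q r))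
  | _ => 0
  end.

Fact mu_key : unit. Proof. exact: tt. Qed.
Definition mu := locked_with mu_key (fun f g h : LT F =>
  lin_ext (fun p => lin_ext (fun q => lin_ext (mu_basis p q) h) g) f).

Lemma muE f g h : mu f g h =
  lin_ext (fun p => lin_ext (fun q => lin_ext (mu_basis p q) h) g) f.
Proof. by rewrite /mu unlock. Qed.

Lemma mu_monomial p q r : mu [p] [q] [r] = mu_basis p q r.
Proof. by rewrite !muE !lin_ext_monomial. Qed.

Lemma mu_linear1 g h : linear (fun f => mu f g h).
Proof. by move=> k f f'; rewrite !muE linearP. Qed.

Lemma mu_linear2 f h : linear (fun g => mu f g h).
Proof.
move=> k g g'; rewrite !muE -lin_ext_lincomb.
by apply: eq_lin_ext => p _; rewrite linearP.
Qed.

Lemma mu_linear3 f g : linear (mu f g).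
Proof.
move=> k h h'; rewrite !muE -lin_ext_lincomb; apply: eq_lin_ext => p _.
by rewrite -lin_ext_lincomb; apply: eq_lin_ext => q _; rewrite linearP.
Qed.

Lemma muD : ((forall f f' g h, (mu (f + f') g h = mu f g h + mu f' g h)%R)
  * (forall f g g' h, (mu f (g + g') h = mu f g h + mu f g' h)%R)
  * (forall f g h h', (mu f g (h + h') = mu f g h + mu f g h')%R))%type.
Proof.
by split=> [|f g]; first split=> [f f' g h|f g g' h];
  [have [+ _ _ _] := linear_morph (mu_linear1 g h)
  |have [+ _ _ _] := linear_morph (mu_linear2 f h)
  |have [+ _ _ _] := linear_morph (mu_linear3 f g)]; apply.
Qed.

Lemma muN : ((forall f g h, (mu (- f) g h = - mu f g h)%R)
  * (forall f g h, (mu f (- g) h = - mu f g h)%R)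
  * (forall f g h, (mu f g (- h) = - mu f g h)%R))%type.
Proof.
by split=> [|f g h]; first split=> f g h;
  [have [_ + _ _] := linear_morph (mu_linear1 g h)
  |have [_ + _ _] := linear_morph (mu_linear2 f h)
  |have [_ + _ _] := linear_morph (mu_linear3 f g)]; apply.
Qed.

Lemma muZ : ((forall (k : F) f g h, (mu (k *: f) g h = k *: mu f g h)%R)
  * (forall (k : F) f g h, (mu f (k *: g) h = k *: mu f g h)%R)
  * (forall (k : F) f g h, (mu f g (k *: h) = k *: mu f g h)%R))%type.
Proof.
by split=> [|k f g h]; first split=> k f g h;
  [have [_ _ + _] := linear_morph (mu_linear1 g h)
  |have [_ _ + _] := linear_morph (mu_linear2 f h)
  |have [_ _ + _] := linear_morph (mu_linear3 f g)]; apply.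
Qed.

Lemma mu0 : ((forall g h, (mu 0 g h = 0)%R) * (forall f h, (mu f 0 h = 0)%R)
  * (forall f g, (mu f g 0 = 0)%R))%type.
Proof.
by split=> [|f g]; first split=> [g h|f h];
  [have [_ _ _ +] := linear_morph (mu_linear1 g h)
  |have [_ _ _ +] := linear_morph (mu_linear2 f h)
  |have [_ _ _ +] := linear_morph (mu_linear3 f g)].
Qed.

(** * The sign twist *)

Lemma sign_even m n k : m = (n + k.*2)%N -> (-1) ^+ m = (-1) ^+ n :> F.
Proof. by move=> ->; rewrite exprD -muln2 exprM sqrr_sign mulr1. Qed.

(** Koszul signs are carried by the grading automorphism [twist 1], so that
    identities stay linear in every variable instead of being restricted to
    homogeneous elements. *)
Fact twist_key : unit. Proof. exact: tt. Qed.
Definition twist := locked_with twist_key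
  (fun k => lin_ext (fun p => (-1) ^+ (k * weight p) *: [p])).

Lemma twistE k : twist k = lin_ext (fun p => (-1) ^+ (k * weight p) *: [p]).
Proof. by rewrite /twist unlock. Qed.

Lemma mcoeff_twist k f p : (twist k f)@_p = (-1) ^+ (k * weight p) * f@_p.
Proof.
rewrite twistE mcoeff_lin_ext.
under eq_bigr => q _ do rewrite mcoeff_LTZ mcoeff_monomial.
have [pf|/mcoeff_outdom pf] := boolP (p \in msupp f).
  rewrite (big_fsetD1 p) //= eqxx mulr1 mulrC.
  rewrite big_seq big1 ?addr0 // => q; rewrite in_fsetD1 => /andP[qp _].
  by rewrite (negPf qp) !mulr0.
rewrite pf mulr0 big1_seq // => q _.
by case: eqP => [->|_]; rewrite ?pf ?mul0r ?mulr0.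
Qed.

Lemma twist_linear k : linear (twist k).
Proof. rewrite twistE; exact: lin_ext_is_linear. Qed.

Lemma twist_monomial k p : twist k [p] = (-1) ^+ (k * weight p) *: [p].
Proof. by rewrite twistE lin_ext_monomial. Qed.

Lemma twist_add k l f : twist k (twist l f) = twist (k + l) f.
Proof. by apply/malgP => p; rewrite !mcoeff_twist mulrA mulnDl exprD. Qed.

Lemma twistC k l f : twist k (twist l f) = twist l (twist k f).
Proof. by rewrite !twist_add addnC. Qed.

Lemma twist_double k f : twist k.*2 f = f.
Proof.
by apply/malgP => p; rewrite mcoeff_twist -doubleMl -muln2 exprM sqrr_sign mul1r.
Qed.

Lemma mu_basis_weight p q r s : s \in msupp (mu_basis p q r) ->
  weight s = (weight p + weight q + weight r).+1.
Proof.
elim: p q r s => [|a _ d IHd e IHe] q r s /=.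
  by rewrite msupp_monomial inE => /eqP->.
case: a => [|? ? ?]; last by rewrite msupp0.
rewrite msuppN => /(fsubsetP (msuppD_le _ _)); rewrite inE => /orP[].
  by move=> /msupp_lin_ext[b /IHd wb]; rewrite msupp_monomial inE => /eqP-> /=; lia.
move=> /(fsubsetP (msuppZ_le _ _)) /msupp_lin_ext[c /IHe wc].
by rewrite msupp_monomial inE => /eqP-> /=; lia.
Qed.

Lemma twist_homogeneous k n f : {in msupp f, forall p, weight p = n} ->
  twist k f = (-1) ^+ (k * n) *: f.
Proof.
move=> wf; apply/malgP => p; rewrite mcoeff_twist mcoeff_LTZ.
by have [/wf->|/mcoeff_outdom->] := boolP (p \in msupp f); rewrite ?mulr0.
Qed.

(** The extra sign is the parity of t, which [twist k] also has to cross. *)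
Lemma twist_mu k f g h :
  twist k (mu f g h) = (-1) ^+ k *: mu (twist k f) (twist k g) (twist k h).
Proof.
apply: (linear_ext (phi := fun f => twist k (mu f g h))
   (psi := fun f => (-1) ^+ k *: mu (twist k f) (twist k g) (twist k h))).
- by move=> s x y /=; rewrite mu_linear1 twist_linear.
- by move=> s x y /=; rewrite twist_linear mu_linear1 scalerDr !scalerA mulrC.
move=> p; apply: (linear_ext (phi := fun g => twist k (mu [p] g h))
   (psi := fun g => (-1) ^+ k *: mu (twist k [p]) (twist k g) (twist k h))).
- by move=> s x y /=; rewrite mu_linear2 twist_linear.
- by move=> s x y /=; rewrite twist_linear mu_linear2 scalerDr !scalerA mulrC.
move=> q; apply: (linear_ext (phi := fun h => twist k (mu [p] [q] h))
   (psi := fun h => (-1) ^+ k *: mu (twist k [p]) (twist k [q]) (twist k h))).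
- by move=> s x y /=; rewrite mu_linear3 twist_linear.
- by move=> s x y /=; rewrite twist_linear mu_linear3 scalerDr !scalerA mulrC.
move=> r; rewrite !twist_monomial !muZ mu_monomial.
rewrite (twist_homogeneous _ (@mu_basis_weight p q r)) !scalerA -!exprD.
by congr (_ ^+ _ *: _); lia.
Qed.

(** * The defining relation holds in the algebra *)

Lemma mu_Leafl f r : mu [L] f [r] = lin_ext (fun b => [Node Leaf b r]) f.
Proof.
rewrite !muE lin_ext_monomial; apply: eq_lin_ext => b _.
exact: lin_ext_monomial.
Qed.

Lemma mu_Leafr q f : mu [L] [q] f = lin_ext (fun c => [Node Leaf q c]) f.
Proof. by rewrite !muE !lin_ext_monomial. Qed.

(** On trees this is the second clause of [mu_basis]; it only remains to extend
    by linearity in each of the four variables. *)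
Lemma mu_Node_Leaf f g u v : mu (mu [L] f g) u v
  + mu [L] (mu f g u) v + mu [L] (twist 1 f) (mu g u v) = 0.
Proof.
suff H p q r s : mu (mu [L] [p] [q]) [r] [s] =
  - (mu [L] (mu [p] [q] [r]) [s] + mu [L] (twist 1 [p]) (mu [q] [r] [s])).
  suff -> : mu (mu [L] f g) u v =
    - (mu [L] (mu f g u) v + mu [L] (twist 1 f) (mu g u v)) by rewrite -addrA addNr.
  apply: (linear_ext (phi := fun f => mu (mu [L] f g) u v) (psi := fun f =>
    - (mu [L] (mu f g u) v + mu [L] (twist 1 f) (mu g u v)))).
  - by move=> s x y /=; rewrite mu_linear2 mu_linear1.
  - by move=> s x y /=; rewrite twist_linear mu_linear1 !mu_linear2
      lincombD opprD scalerN.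
  move=> p; apply: (linear_ext (phi := fun g => mu (mu [L] [p] g) u v) (psi := fun g =>
    - (mu [L] (mu [p] g u) v + mu [L] (twist 1 [p]) (mu g u v)))).
  - by move=> s x y /=; rewrite mu_linear3 mu_linear1.
  - by move=> s x y /=; rewrite mu_linear1 !mu_linear2 mu_linear3
      lincombD opprD scalerN.
  move=> q; apply: (linear_ext (phi := fun u => mu (mu [L] [p] [q]) u v) (psi := fun u =>
    - (mu [L] (mu [p] [q] u) v + mu [L] (twist 1 [p]) (mu [q] u v)))).
  - by move=> s x y /=; rewrite mu_linear2.
  - by move=> s x y /=; rewrite mu_linear3 !mu_linear2 mu_linear3
      lincombD opprD scalerN.
  move=> r; apply: (linear_ext (phi := mu (mu [L] [p] [q]) [r]) (psi := fun v =>
    - (mu [L] (mu [p] [q] [r]) v + mu [L] (twist 1 [p]) (mu [q] [r] v)))).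
  - exact: mu_linear3.
  - by move=> s x y /=; rewrite !mu_linear3
      lincombD opprD scalerN.
  exact: H.
by rewrite (mu_monomial Leaf) twist_monomial mul1n muZ mu_Leafl mu_Leafr !mu_monomial.
Qed.

(** Confluence of the overlap of t o_1 t with itself. Write R(x,y,z,u,v) for the
    left-hand side. If the first factor is x = mu Leaf d e, expanding every
    product on the left turns R(x,y,z,u,v) into
    mu Leaf R(d,e,y,z,u) v + mu Leaf d R(e,y,z,u,v) plus two terms
    mu Leaf (mu d e y) (mu z u v), up to twists; these cancel because t is odd.
    Induction on the first factor then applies, with arbitrary other factors. *)
Lemma mu_relation_monomial p y z u v : mu (mu [p] y z) u v
  + mu (twist 1 [p]) (mu y z u) v + mu (twist 1 [p]) (twist 1 y) (mu z u v) = 0.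
Proof.
elim: p y z u v => [|a _ d IHd e IHe] y z u v.
  rewrite twist_monomial muln0 scale1r; exact: mu_Node_Leaf.
case: a => [|a1 a2 a3]; last first.
  have mu_a g h : mu [Node (Node a1 a2 a3) d e] g h = 0.
    rewrite !muE lin_ext_monomial /= -[RHS](lin_ext0 g).
    by apply: eq_lin_ext => q _; rewrite [LHS]lin_ext0.
  by rewrite twist_monomial !muZ !mu_a !mu0 !scaler0 !addr0.
have -> : [Node Leaf d e] = mu [L] [d] [e] by rewrite mu_monomial.
have twistL : twist 1 [L] = [L] by rewrite twist_monomial muln0 scale1r.
have twist2 f : twist 1 (twist 1 f) = f by rewrite twist_add (twist_double 1).
set D := [d]; set E := [e].
have twist1_mu f g h : twist 1 (mu f g h) = - mu (twist 1 f) (twist 1 g) (twist 1 h).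
  by rewrite twist_mu expr1 scaleN1r.
have XE f g h w : mu (mu [L] f g) h w =
    - (mu [L] (mu f g h) w + mu [L] (twist 1 f) (mu g h w)).
  by apply/eqP; rewrite -addr_eq0 addrA mu_Node_Leaf.
rewrite !twist1_mu twistL !(muN, muD, XE) !(twist1_mu, twist2) !(muN, opprK, opprD).
(* Terms 1, 3, 5 are the relation for d, terms 4, 6, 8 the one for e, and terms
   2 and 7 cancel. *)
rewrite [LHS](AC (2*2*2*2) (1*3*5*(4*6*8)*(7*2))) /= subrr addr0.
by rewrite -!muD IHd IHe !mu0 addr0.
Qed.

Lemma mu_relation x y z u v : mu (mu x y z) u v
  + mu (twist 1 x) (mu y z u) v + mu (twist 1 x) (twist 1 y) (mu z u v) = 0.
Proof.
apply: (linear_ext (phi := fun x => mu (mu x y z) u v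
  + mu (twist 1 x) (mu y z u) v + mu (twist 1 x) (twist 1 y) (mu z u v))
  (psi := fun=> 0)) => [s f g|s f g|p] /=.
- by rewrite twist_linear !mu_linear1 !lincombD.
- by rewrite scaler0 addr0.
exact: mu_relation_monomial.
Qed.

(** * The action of the operad on the algebra *)

Implicit Types (s : nat -> LT F) (i j : nat).

(** The action of the tree p on the elements s 1, s 2, ... placed at its leaves.
    In the word of p, read in preorder, each argument has to move left from the
    end of the word to its leaf, past the nodes that follow that leaf: this is
    where the twists come from. *)
Fixpoint eval p s : LT F :=
  match p with
  | Leaf => s 1%N
  | Node a b c =>
      mu (eval a (fun i => twist (weight b + weight c) (s i)))
         (eval b (fun i => twist (weight c) (s (arity a + i)%N)))
         (eval c (fun i => s (arity a + arity b + i)%N))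
  end.

Lemma eq_eval p s s' : (forall i, (1 <= i <= arity p)%N -> s i = s' i) ->
  eval p s = eval p s'.
Proof.
elim: p s s' => [|a IHa b IHb c IHc] s s' /= eq_s; first exact: eq_s.
congr mu; [apply: IHa => i ir | apply: IHb => i ir | apply: IHc => i ir];
  by rewrite eq_s //; lia.
Qed.

(** Twisting all arguments twists the value, up to one sign for each node. *)
Lemma eval_twist k p s :
  eval p (fun i => twist k (s i)) = (-1) ^+ (k * weight p) *: twist k (eval p s).
Proof.
elim: p s => [|a IHa b IHb c IHc] s /=; first by rewrite muln0 scale1r.
rewrite (eq_eval (s' := fun i => twist k (twist (weight b + weight c) (s i))));
  last by move=> i _; exact: twistC.
rewrite (eq_eval (p := b)
  (s' := fun i => twist k (twist (weight c) (s (arity a + i)%N))));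
  last by move=> i _; exact: twistC.
rewrite IHa IHb IHc twist_mu !muZ !scalerA -!exprD; congr (_ *: _).
by symmetry; apply: (@sign_even _ _ k); lia.
Qed.

Lemma eval_linear p s s1 s2 j (k : F) : (1 <= j <= arity p)%N ->
  s j = k *: s1 j + s2 j -> (forall i, i != j -> s1 i = s i /\ s2 i = s i) ->
  eval p s = k *: eval p s1 + eval p s2.
Proof.
elim: p s s1 s2 j => [|a IHa b IHb c IHc] s s1 s2 j /= jr sj s_eq.
  by have <- : j = 1%N by lia.
have eq_off p m (t : LT F -> LT F) :
    (forall i, (1 <= i <= arity p)%N -> (m + i)%N != j) ->
    eval p (fun i => t (s1 (m + i)%N)) = eval p (fun i => t (s (m + i)%N)) /\
    eval p (fun i => t (s2 (m + i)%N)) = eval p (fun i => t (s (m + i)%N)).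
  by move=> off; split; apply: eq_eval => i /off/s_eq [e1 e2]; rewrite ?e1 ?e2.
have [ja|ja] := leqP j (arity a).
  have [|-> ->] := eq_off b (arity a) (twist (weight c)); first by move=> i; lia.
  have [|-> ->] := eq_off c (arity a + arity b)%N id; first by move=> i; lia.
  rewrite -mu_linear1; congr mu; apply: (IHa _ _ _ j) => [||i ij].
  - lia.
  - by rewrite sj twist_linear.
  by have [-> ->] := s_eq i ij.
have [|-> ->] := eq_off a 0%N (twist (weight b + weight c)); first by move=> i; lia.
have [jb|jb] := leqP j (arity a + arity b).
  have [|-> ->] := eq_off c (arity a + arity b)%N id; first by move=> i; lia.
  rewrite -mu_linear2; congr mu; apply: (IHb _ _ _ (j - arity a)%N) => [||i ij].
  - lia.
  - by rewrite subnKC ?sj ?twist_linear //; lia.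
  by have [|-> ->] := s_eq (arity a + i)%N; first lia.
have [|-> ->] := eq_off b (arity a) (twist (weight c)); first by move=> i; lia.
rewrite -mu_linear3; congr mu; apply: (IHc _ _ _ (j - arity a - arity b)%N) => [||i ij].
- lia.
- by rewrite -subnDA subnKC ?sj //; lia.
by have [|-> ->] := s_eq (arity a + arity b + i)%N; first lia.
Qed.

Lemma eval0 p s j : (1 <= j <= arity p)%N -> s j = 0 -> eval p s = 0.
Proof.
by move=> jr sj; rewrite (@eval_linear p s s s j (-1) jr) ?scaleN1r ?addNr.
Qed.

Lemma eval_scale p s s1 j (k : F) : (1 <= j <= arity p)%N ->
  s j = k *: s1 j -> (forall i, i != j -> s i = s1 i) -> eval p s = k *: eval p s1.
Proof.
move=> jr sj s_eq.
rewrite (@eval_linear p s s1 (fun i => if i == j then 0 else s i) j k) //.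
- by rewrite [X in _ + X](@eval0 _ _ j) ?eqxx // addr0.
- by rewrite eqxx addr0.
by move=> i ij; rewrite (negPf ij) s_eq.
Qed.

(** The arguments fed to p when q, with its own arguments, is placed at leaf i.
    The arguments at earlier leaves are twisted because q crosses them. *)
Definition plug q i s : nat -> LT F := fun k =>
  if (k < i)%N then twist (weight q) (s k)
  else if k == i then eval q (fun m => s (i.-1 + m)%N)
  else s (k + arity q - 1)%N.

Local Ltac plug_lia := rewrite /plug;
  repeat match goal with
  | |- context [if ?x then _ else _] =>
      first [have -> : x = true by lia | have -> : x = false by lia]
  end.

(** Only the argument at leaf i makes a difference: there the twist has to cross
    the nodes of q. *)
Lemma eval_plug_twist p q i s k : (1 <= i <= arity p)%N ->
  eval p (plug q i (fun j => twist k (s j))) =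
  (-1) ^+ (k * weight q) *: eval p (fun j => twist k (plug q i s j)).
Proof.
move=> ir; apply: (eval_scale (j := i)) => // [|j ji].
  by rewrite /plug ltnn eqxx eval_twist.
by rewrite /plug (negPf ji); case: ifP => // _; exact: twistC.
Qed.

Lemma plug_shift q i n s j : (n < i)%N -> (1 <= j)%N ->
  plug q (i - n) (fun k => s (n + k)%N) j = plug q i s (n + j)%N.
Proof.
have q0 : (0 < arity q)%N by rewrite arityE.
move=> ni j1; rewrite /plug; case: (ltnP j (i - n)) => h.
  by have -> : (n + j < i)%N by lia.
have -> : (n + j < i)%N = false by lia.
have -> : (j == i - n)%N = (n + j == i)%N by lia.
case: eqP => _; last by congr s; lia.
by apply: eq_eval => k kr; congr s; lia.
Qed.

(** Evaluation is compatible with partial composition: the sign on the left is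
    the Koszul sign of [comp], so this says that [eval] is an action of the
    operad. *)
Lemma eval_graft p i q s : (1 <= i <= arity p)%N ->
  (-1) ^+ (weight q * after p i) *: eval (graft p i q) s = eval p (plug q i s).
Proof.
have q0 : (0 < arity q)%N by rewrite arityE.
elim: p i s => [|a IHa b IHb c IHc] i s /= ir.
  have -> : i = 1%N by lia.
  by rewrite muln0 scale1r /plug.
case: (leqP i (arity a)) => ia /=.
  have ha : (arity (graft a i q)).+1 = (arity a + arity q)%N.
    by apply: arity_graft; lia.
  have -> /= : eval c (fun j => s (arity (graft a i q) + arity b + j)%N) =
      eval c (fun j => plug q i s (arity a + arity b + j)%N).
    by apply: eq_eval => j jr; plug_lia; congr s; lia.
  have -> : eval b (fun j => twist (weight c) (s (arity (graft a i q) + j)%N)) =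
      eval b (fun j => twist (weight c) (plug q i s (arity a + j)%N)).
    by apply: eq_eval => j jr; plug_lia; congr (twist _ (s _)); lia.
  rewrite -muZ; congr mu.
  have ir' : (1 <= i <= arity a)%N by lia.
  have := IHa i (fun j => twist (weight b + weight c) (s j)) ir'.
  rewrite eval_plug_twist //.
  move=> /(congr1 ( *:%R ((-1) ^+ ((weight b + weight c) * weight q)))).
  rewrite !scalerA -!exprD.
  rewrite [X in _ = X *: _](@sign_even _ 0 ((weight b + weight c) * weight q));
    last lia.
  rewrite scale1r => <-; congr (_ *: _); congr (_ ^+ _); lia.
case: (leqP i (arity a + arity b)) => ib /=.
  have hb : (arity (graft b (i - arity a) q)).+1 = (arity b + arity q)%N.
    by apply: arity_graft; lia.
  have wb : weight (graft b (i - arity a) q) = (weight b + weight q)%N.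
    by apply: weight_graft; lia.
  have -> /= : eval c (fun j => s (arity a + arity (graft b (i - arity a) q) + j)%N) =
      eval c (fun j => plug q i s (arity a + arity b + j)%N).
    by apply: eq_eval => j jr; plug_lia; congr s; lia.
  have -> : eval a (fun j => twist (weight (graft b (i - arity a) q) + weight c) (s j)) =
      eval a (fun j => twist (weight b + weight c) (plug q i s j)).
    by apply: eq_eval => j jr; plug_lia; rewrite twist_add; congr (twist _ (s _)); lia.
  have ir' : (1 <= i - arity a <= arity b)%N by lia.
  have := IHb (i - arity a)%N (fun j => twist (weight c) (s (arity a + j)%N)) ir'.
  rewrite eval_plug_twist //.
  move=> /(congr1 ( *:%R ((-1) ^+ (weight c * weight q)))).
  rewrite !scalerA -!exprD.
  rewrite [X in _ = X *: _](@sign_even _ 0 (weight c * weight q)); last lia.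
  rewrite scale1r -muZ.1.2 => e; congr mu.
  transitivity (eval b (fun j => twist (weight c)
    (plug q (i - arity a) (fun j => s (arity a + j)%N) j))).
    rewrite -e; congr (_ *: _); congr (_ ^+ _); lia.
  apply: eq_eval => j jr; congr (twist _ _); apply: plug_shift; lia.
have wc : weight (graft c (i - arity a - arity b) q) = (weight c + weight q)%N.
  by apply: weight_graft; lia.
have -> /= : eval a (fun j =>
        twist (weight b + weight (graft c (i - arity a - arity b) q)) (s j)) =
      eval a (fun j => twist (weight b + weight c) (plug q i s j)).
  by apply: eq_eval => j jr; plug_lia; rewrite twist_add; congr (twist _ (s _)); lia.
have -> : eval b (fun j =>
        twist (weight (graft c (i - arity a - arity b) q)) (s (arity a + j)%N)) =
      eval b (fun j => twist (weight c) (plug q i s (arity a + j)%N)).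
  by apply: eq_eval => j jr; plug_lia; rewrite twist_add; congr (twist _ (s _)); lia.
rewrite -muZ.2; congr mu.
rewrite -(subnDA (arity a)) IHc; last lia.
by apply: eq_eval => j jr; apply: plug_shift; lia.
Qed.

(** Linearity of the evaluation in the argument at one leaf, for finite sums. *)
Lemma eval_sum (r : seq tree) (k : tree -> F) (s' : tree -> nat -> LT F) p s j :
  (1 <= j <= arity p)%N -> s j = \sum_(q <- r) k q *: s' q j ->
  {in r, forall q i, i != j -> s' q i = s i} ->
  eval p s = \sum_(q <- r) k q *: eval p (s' q).
Proof.
move=> jr; elim: r s => [|q r IHr] s.
  by rewrite !big_nil => sj _; exact: eval0 sj.
rewrite !big_cons => sj s_eq.
pose s2 i := if i == j then \sum_(q <- r) k q *: s' q j else s i.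
rewrite (@eval_linear p s (s' q) s2 j (k q)) //; last 2 first.
- by rewrite /s2 eqxx.
- by move=> i ij; rewrite s_eq ?mem_head // /s2 (negPf ij).
congr (_ + _); apply: IHr => [|q' q'r i ij]; first by rewrite /s2 eqxx.
by rewrite /s2 (negPf ij) s_eq // inE q'r orbT.
Qed.

(** * The annihilator of the algebra is an ideal *)

Definition eval_in n s p : LT F := if arity p == n then eval p s else 0.

(** The annihilator of the algebra, taken in each arity separately so that it is
    a homogeneous subspace. *)
Definition acts_by_zero f : Prop := forall n s, lin_ext (eval_in n s) f = 0.

Lemma lin_ext_operad_comp phi i f g : lin_ext phi (comp i f g) =
  \sum_(p <- msupp f) \sum_(q <- msupp g)
    (f@_p * g@_q) *: (comp_sign p i q *: phi (graft p i q)).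
Proof.
rewrite /comp linear_sum; apply: eq_bigr => p _.
rewrite linear_sum; apply: eq_bigr => q _.
by rewrite linearZ /= lin_ext_monomial scalerA.
Qed.

Lemma comp_sign_eval_in n s p i q : (1 <= i <= arity p)%N ->
  comp_sign p i q *: eval_in n s (graft p i q) =
  if (arity p + arity q).-1 == n then eval p (plug q i s) else 0.
Proof.
move=> ir; rewrite /eval_in /comp_sign -(arity_graft q ir) /=.
by case: ifP => _; rewrite ?scaler0 ?eval_graft.
Qed.

Lemma acts_by_zero_component n f : acts_by_zero f -> acts_by_zero (component n f).
Proof.
move=> f0 m s; rewrite /component linear_sum big_mkcond /=.
have [<-|nm] := eqVneq n m.
  rewrite -[RHS](f0 n s); apply: eq_bigr => p _.
  rewrite linearZ /= lin_ext_monomial /eval_in.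
  by case: (arity p == n); rewrite ?scaler0.
apply: big1 => p _; case: ifP => // /eqP pn.
by rewrite linearZ /= lin_ext_monomial /eval_in pn (negPf nm) scaler0.
Qed.

Lemma acts_by_zero_compl m n i f g : homogeneous m f -> homogeneous n g ->
  acts_by_zero f -> (1 <= i <= m)%N -> acts_by_zero (comp i f g).
Proof.
move=> /allP hf /allP hg f0 ir k s; rewrite lin_ext_operad_comp exchange_big /=.
rewrite big1_seq // => q /= qg.
transitivity (g@_q *: (if (m + n).-1 == k then lin_ext (eval_in m (plug q i s)) f
                       else 0)); last by case: ifP; rewrite ?f0 scaler0.
have -> : (if (m + n).-1 == k then lin_ext (eval_in m (plug q i s)) f else 0)
  = \sum_(p <- msupp f) f@_p *:
     (if (m + n).-1 == k then eval_in m (plug q i s) p else 0).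
  by case: ifP => // _; rewrite big1 // => p _; rewrite scaler0.
rewrite scaler_sumr; apply: eq_big_seq => p pf.
rewrite comp_sign_eval_in ?(eqP (hf p pf)) // (eqP (hg q qg)) /eval_in.
by rewrite (hf p pf) scalerA mulrC.
Qed.

Lemma acts_by_zero_compr m n j f g : homogeneous m f -> homogeneous n g ->
  acts_by_zero f -> (1 <= j <= n)%N -> acts_by_zero (comp j g f).
Proof.
move=> /allP hf /allP hg f0 jr k s; rewrite lin_ext_operad_comp.
rewrite big1_seq // => p /= pg.
have jp : (1 <= j <= arity p)%N by rewrite (eqP (hg p pg)).
transitivity (g@_p *: (if (n + m).-1 == k then
    \sum_(q <- msupp f) f@_q *: eval p (plug q j s) else 0)).
  have -> : (if (n + m).-1 == k then
    \sum_(q <- msupp f) f@_q *: eval p (plug q j s) else 0)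
    = \sum_(q <- msupp f) f@_q *:
       (if (n + m).-1 == k then eval p (plug q j s) else 0).
    by case: ifP => // _; rewrite big1 // => q _; rewrite scaler0.
  rewrite scaler_sumr; apply: eq_big_seq => q qf.
  by rewrite comp_sign_eval_in // (eqP (hf q qf)) (eqP (hg p pg)) scalerA.
case: ifP => _; last by rewrite scaler0.
(* All trees of f have arity m, hence the same weight m./2, so the arguments
   away from leaf j do not depend on the tree plugged there. *)
pose s0 i := if (i < j)%N then twist m./2 (s i)
  else if i == j then 0 else s (i + m - 1)%N.
rewrite -(@eval_sum (msupp f) (fun q => f@_q) (fun q => plug q j s) p s0 j) //.
- by rewrite (@eval0 _ _ j) ?scaler0 // /s0 ltnn eqxx.
- rewrite /s0 /plug ltnn eqxx -[LHS](f0 m (fun i => s (j.-1 + i)%N)).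
  by rewrite /lin_ext; apply: eq_big_seq => q qf; rewrite /eval_in hf.
move=> q qf i ij; rewrite /s0 /plug (negPf ij) (eqP (hf q qf)).
suff -> : weight q = m./2 by [].
by rewrite -(eqP (hf q qf)) arityE; lia.
Qed.

(** The three trees of alpha evaluate to the three terms of [mu_relation]. *)
Lemma acts_by_zero_alpha : acts_by_zero (alpha F).
Proof.
move=> n s; rewrite alphaE !linearD /= !lin_ext_monomial /eval_in /=.
case: eqP => _; last by rewrite !addr0.
have twist0 f : twist 0 f = f := twist_double 0 f.
rewrite !(add0n, addn0, twist0); exact: mu_relation.
Qed.

Lemma ideal_acts_by_zero f : ideal_gen [:: alpha F] f -> acts_by_zero f.
Proof.
apply; last by move=> g; rewrite inE => /eqP->; exact: acts_by_zero_alpha.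
split.
- by move=> n s; rewrite linear0.
- by move=> f1 f2 f10 f20 n s; rewrite linearD /= f10 f20 addr0.
- by move=> k f1 f10 n s; rewrite linearZ /= f10 scaler0.
- exact: acts_by_zero_component.
- exact: acts_by_zero_compl.
- exact: acts_by_zero_compr.
Qed.

(** * Normal forms and leading monomials *)

(** Letting p act on leaves rewrites p, modulo alpha, into a combination of
    normal trees. *)
Definition normal_form p : LT F := eval p (fun=> [L]).

Lemma normal_form_Node a b c : normal_form (Node a b c) =
  mu (normal_form a) (normal_form b) (normal_form c).
Proof.
have twistL k : twist k [L] = [L] by rewrite twist_monomial muln0 scale1r.
by rewrite /normal_form /=; congr mu; apply: eq_eval => i _; rewrite twistL.
Qed.

Fixpoint normal p :=
  if p is Node a b c then [&& a == Leaf, normal b & normal c] else true.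

Lemma normal_form_id p : normal p -> normal_form p = [p].
Proof.
elim: p => // a _ b IHb c IHc /= /and3P[/eqP-> /IHb nb /IHc nc].
by rewrite normal_form_Node nb nc mu_monomial.
Qed.

(** A product with a first factor other than a leaf is strictly smaller in the
    path-lex order than the corresponding node: its first leaf moves up to
    depth 1. *)
Lemma mu_basis_shape p q r t : p != Leaf -> t \in msupp (mu_basis p q r) ->
  exists b c, t = Node Leaf b c.
Proof.
case: p => [|[|? ? ?] d e] //= _; last by rewrite msupp0.
rewrite msuppN => /(fsubsetP (msuppD_le _ _)); rewrite inE.
move=> /orP[|/(fsubsetP (msuppZ_le _ _))];
  move=> /msupp_lin_ext[b _]; rewrite msupp_monomial inE => /eqP->.
  by exists b, r.
by exists d, b.
Qed.

Lemma msupp_mu f g h t : t \in msupp (mu f g h) -> exists p q r,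
  [/\ p \in msupp f, q \in msupp g, r \in msupp h & t \in msupp (mu_basis p q r)].
Proof.
rewrite muE => /msupp_lin_ext[p pf] /msupp_lin_ext[q qg] /msupp_lin_ext[r rh] sm.
by exists p, q, r.
Qed.

Lemma lexi_cat (s1 s2 t1 t2 : seqlexi nat) : size s1 = size s2 ->
  (s1 <= s2)%O -> (t1 <= t2)%O -> ((s1 ++ t1 : seqlexi nat) <= s2 ++ t2)%O.
Proof.
elim: s1 s2 => [|x s1 IHs] [|y s2] //= [sz]; rewrite !lexi_cons => /andP[xy h] t12.
rewrite xy /=; apply/implyP => yx; apply: IHs => //; exact: (implyP h).
Qed.

Lemma lexi_map_succ (s1 s2 : seqlexi nat) : size s1 = size s2 ->
  (s1 <= s2)%O -> ((map S s1 : seqlexi nat) <= map S s2)%O.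
Proof.
elim: s1 s2 => [|x s1 IHs] [|y s2] //= [sz]; rewrite !lexi_cons => /andP[xy h].
apply/andP; split=> //; apply/implyP => yx; apply: IHs => //; exact: (implyP h).
Qed.

Lemma path_seq_head p :
  exists n w, path_seq p = n :: w /\ (n == 0%N) = (p == Leaf).
Proof.
elim: p => [|a [n [w [e _]]] b _ c _]; first by exists 0%N, [::]; rewrite eqxx.
by exists n.+1, (map S (w ++ path_seq b ++ path_seq c)); rewrite /= e.
Qed.

Lemma path_le_Node_Leaf b c b' c' : arity b = arity b' ->  arity c = arity c' ->
  path_le b b' -> path_le c c' -> path_le (Node Leaf b c) (Node Leaf b' c').
Proof.
move=> ab ac lb lc; rewrite /path_le /= lexi_cons lexx /=.
apply: lexi_map_succ; first by rewrite !size_cat !size_path_seq ab ac.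
by apply: lexi_cat; rewrite ?size_path_seq.
Qed.

(** Rewriting never increases a tree. Either the first child of the root is a
    leaf and the rewriting takes place in the other two children, or the first
    leaf of the result has depth 1, whereas in the original it was deeper. *)
Lemma normal_form_le p q : q \in msupp (normal_form p) ->
  weight q = weight p /\ path_le q p.
Proof.
elim: p q => [|a IHa b IHb c IHc] q.
  by rewrite msupp_monomial inE => /eqP->; rewrite /path_le lexx.
rewrite normal_form_Node => /msupp_mu[x [y [z [xa yb zc qm]]]].
have [[[wx _] [wy ly]] [wz lz]] := (IHa _ xa, IHb _ yb, IHc _ zc).
split; first by rewrite (mu_basis_weight qm) /=; lia.
have [x0|x_node] := eqVneq x Leaf.
  have -> : a = Leaf by case: (a) wx; rewrite x0.
  move: qm; rewrite x0 msupp_monomial inE => /eqP->.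
  by apply: path_le_Node_Leaf => //; rewrite !arityE; lia.
have [d [e ->]] := mu_basis_shape x_node qm.
have [n [w [pa n0]]] := path_seq_head a.
rewrite /path_le /= pa /= lexi_cons leEnat /= ltnS leqn0 n0.
by case: (a) wx => //; case: (x) x_node.
Qed.

Lemma divides_Node_child a b c p :
  p \in [:: b; c] -> divides a p -> divides a (Node Leaf b c).
Proof.
move=> p_bc [r [j [w [jr wa pE]]]].
move: p_bc; rewrite !inE => /orP[]/eqP pc.
  exists (Node Leaf r c), (1 + j)%N, w; split=> //=; first lia.
  have -> : (1 + j <= 1)%N = false by lia.
  have -> : (1 + j <= 1 + arity r)%N by lia.
  by rewrite addKn -pE pc.
exists (Node Leaf b r), (1 + arity b + j)%N, w; split=> //=; first lia.
have -> : (1 + arity b + j <= 1)%N = false by lia.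
have -> : (1 + arity b + j <= 1 + arity b)%N = false by lia.
have -> : (1 + arity b + j - 1 - arity b = j)%N by lia.
by rewrite -pE pc.
Qed.

Lemma normal_or_divides p : normal p \/ divides (Node basic_tree Leaf Leaf) p.
Proof.
elim: p => [|a _ b IHb c IHc]; first by left.
case: a => [|a1 a2 a3]; last first.
  by right; exists Leaf, 1%N, [:: a1; a2; a3; b; c].
case: IHb => [nb|db]; last by right; apply: divides_Node_child db; rewrite inE eqxx.
case: IHc => [nc|dc]; last first.
  by right; apply: divides_Node_child dc; rewrite !inE eqxx orbT.
by left; rewrite /= nb nc.
Qed.

Lemma msupp_alpha p : (p \in msupp (alpha F)) = (p \in
  [:: Node basic_tree Leaf Leaf; Node Leaf basic_tree Leaf; Node Leaf Leaf basic_tree]).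
Proof.
rewrite -mcoeff_neq0 alphaE !mcoeff_LTD !mcoeff_monomial !inE !(eq_sym p).
case: (Node basic_tree Leaf Leaf =P p) => [<-|_];
  case: (Node Leaf basic_tree Leaf =P _) => [e2|_] //;
  case: (Node Leaf Leaf basic_tree =P _) => [e3|_] //;
  try by rewrite -e2 in e3.
all: by rewrite ?mulr0n ?mulr1n ?addr0 ?add0r ?oner_eq0 ?eqxx.
Qed.

Lemma alpha_neq0 : alpha F != 0.
Proof.
apply/eqP => alpha0; have := msupp_alpha (Node basic_tree Leaf Leaf).
by rewrite alpha0 msupp0 mem_head.
Qed.

Lemma lm_alpha : lm (alpha F) = Node basic_tree Leaf Leaf.
Proof.
have [] := lmP alpha_neq0; set P := lm _; rewrite msupp_alpha !inE => P_in.
move=> /(_ (Node basic_tree Leaf Leaf)); rewrite msupp_alpha inE eqxx => /(_ isT).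
by case/or3P: P_in => /eqP-> // /(_ isT).
Qed.

Lemma homogeneous_alpha : homogeneous 5 (alpha F).
Proof.
by apply/allP => p; rewrite msupp_alpha !inE => /or3P[]/eqP->.
Qed.

(** The normal forms of the smaller trees of f do not contain the leading
    monomial, so if that tree were its own normal form, its coefficient would
    survive in the value of f on leaves, which is zero. *)
Lemma lm_not_normal f n : f != 0 -> homogeneous n f -> acts_by_zero f ->
  ~~ normal (lm f).
Proof.
move=> f0 /allP hf /(_ n (fun=> [L])) f_zero; apply/negP => normal_lm.
have [lm_in lm_max] := lmP f0.
move: (congr1 (mcoeff (lm f)) f_zero); rewrite mcoeff_lin_ext mcoeff0.
rewrite (big_fsetD1 (lm f)) //= /eval_in hf // -/(normal_form _) normal_form_id //.
rewrite mcoeff_monomial eqxx mulr1 big_seq big1 ?addr0.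
  by apply/eqP; rewrite mcoeff_neq0.
move=> p; rewrite in_fsetD1 => /andP[p_lm pf].
rewrite hf // [X in _ * X]mcoeff_outdom ?mulr0 //.
apply/negP => /normal_form_le[_]; apply/negP; rewrite /path_le -ltNge.
exact: lm_max.
Qed.

End PartiallyAssociativeAlgebra.

Theorem theorem3p13 (F : fieldType) (charF0 : [pchar F] =i pred0) :
  groebner_basis [:: alpha F] (ideal_gen [:: alpha F]).
Proof.
split=> //.
  move=> g; rewrite inE => /eqP->; split; first exact: alpha_neq0.
  by exists 5; exact: homogeneous_alpha.
move=> n f f0 hf /ideal_acts_by_zero f_zero; exists (alpha F).
  by rewrite inE.
rewrite lm_alpha; have [norm|//] := normal_or_divides (lm f).
by have /negP := lm_not_normal f0 hf f_zero.
Qed.
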